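(* Let $E$ be a homogeneous effect algebra. Then $E=\bigcup\{B: B\text{ is a block of }E\}$.
   Context: An effect algebra is a partial algebra $(E;\oplus,0,1)$ with a partial binary operation $\oplus$ and two constants $0,1$ such that: (E1) if $a\oplus b$ is defined, then $b\oplus a$ is defined and $a\oplus b=b\oplus a$; (E2) if $a\oplus b$ and $(a\oplus b)\oplus c$ are defined, then $b\oplus c$ and $a\oplus(b\oplus c)$ are defined and $(a\oplus b)\oplus c=a\oplus(b\oplus c)$; (E3) for every $a\in E$ there is a unique $a'\in E$ with $a\oplus a'=1$; (E4) if $a\oplus 1$ is defined, then $a=0$. Write $a\le b$ iff there is $c\in E$ with $a\oplus c=b$; this is a partial order with least element $0$ and greatest element $1$, and if $a\le b$ then $b\ominus a$ denotes the unique $c$ with $a\oplus c=b$. Write $a\perp b$ iff $a\oplus b$ is defined. A sub-effect algebra of $E$ is a subset $E_0\subseteq E$ with $1\in E_0$ and $a\ominus b\in E_0$ for all $a,b\in E_0$ with $a\ge b$; it is then an effect algebra with the restricted operation. An effect algebra $E$ satisfies the Riesz decomposition property iff for all $u,v_1,\ldots,v_n\in E$ such that $v_1\oplus\cdots\oplus v_n$ exists and $u\le v_1\oplus\cdots\oplus v_n$, there are $u_1,\ldots,u_n\in E$ with $u_i\le v_i$ for all $i$ and $u=u_1\oplus\cdots\oplus u_n$. A block of an effect algebra $E$ is a maximal (with respect to inclusion) sub-effect algebra of $E$ satisfying the Riesz decomposition property. An effect algebra $E$ is homogeneous iff for all $u,v_1,v_2\in E$ such that $v_1\perp v_2$, $u\le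 v_1\oplus v_2$ and $u\le (v_1\oplus v_2)'$, there are $u_1,u_2\in E$ with $u_1\le v_1$, $u_2\le v_2$ and $u=u_1\oplus u_2$. *)

(* Defs.v *)
From mathcomp Require Import all_boot.
From mathcomp Require Import boolp classical_sets.

Set Implicit Arguments.
Unset Strict Implicit.
Unset Printing Implicit Defensive.

Local Open Scope classical_set_scope.

(* The partial operation is option-valued: [oplus a b = Some c] means that the
   sum of a and b is defined and equal to c. *)
Record effectAlgebra := EffectAlgebra {
  ea_sort :> Type;
  oplus : ea_sort -> ea_sort -> option ea_sort;
  ea0 : ea_sort;
  ea1 : ea_sort;
  oplus_comm : forall a b c, oplus a b = Some c -> oplus b a = Some c;
  oplus_assoc : forall a b c ab abc,
    oplus a b = Some ab -> oplus ab c = Some abc ->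
    exists2 bc, oplus b c = Some bc & oplus a bc = Some abc;
  ea_compl_ex : forall a, exists! a', oplus a a' = Some ea1;
  oplus_ea1 : forall a c, oplus a ea1 = Some c -> a = ea0
}.

Arguments ea0 {e}.
Arguments ea1 {e}.

Section EffectAlgebraOps.
Variable E : effectAlgebra.
Implicit Types a b c u v : E.

Definition compl a : E := sval (cid (ea_compl_ex a)).

Definition ea_le a b : Prop := exists c, oplus a c = Some b.

Definition ominus b a (leab : ea_le a b) : E := sval (cid leab).

(* v_1 (+) ... (+) v_n, bracketed to the left; the empty sum is 0. *)
Definition oplus_seq (s : seq E) : option E :=
  if s is x :: s' then foldl (fun o y => obind (fun z => oplus z y) o) (Some x) s'
  else Some ea0.

Lemma oplus_compl a : oplus a (compl a) = Some ea1.
Proof. by rewrite /compl; case: cid => x []. Qed.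

Lemma compl_uniq a b : oplus a b = Some ea1 -> compl a = b.
Proof. by rewrite /compl; case: cid => x [] /= _; apply. Qed.

Lemma oplus_cancel a b c d : oplus a b = Some d -> oplus a c = Some d -> b = c.
Proof.
move=> ab ac.
have [bd e1 e2] := oplus_assoc ab (oplus_compl d).
have [cd e3 e4] := oplus_assoc ac (oplus_compl d).
have ebc : bd = cd by rewrite -(compl_uniq e2) (compl_uniq e4).
rewrite -ebc in e3 e4.
have [x e5 e6] := oplus_assoc e1 (oplus_comm e2).
have [y e7 e8] := oplus_assoc e3 (oplus_comm e4).
have exy : x = y by move: e7; rewrite e5 => -[].
rewrite -exy in e8.
by rewrite -(compl_uniq (oplus_comm e6)) (compl_uniq (oplus_comm e8)).
Qed.

Lemma ominusP b a (leab : ea_le a b) : oplus a (ominus leab) = Some b.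
Proof. by rewrite /ominus; case: cid. Qed.

Lemma ominus_uniq b a c (leab : ea_le a b) :
  oplus a c = Some b -> ominus leab = c.
Proof. exact: oplus_cancel (ominusP leab). Qed.

Definition riesz_decomposition : Prop :=
  forall (n : nat) (u : E) (v : n.-tuple E) (s : E),
    oplus_seq v = Some s -> ea_le u s ->
    exists w : n.-tuple E,
      (forall i, ea_le (tnth w i) (tnth v i)) /\ oplus_seq w = Some u.

Definition homogeneous : Prop :=
  forall u v1 v2 s : E,
    oplus v1 v2 = Some s -> ea_le u s -> ea_le u (compl s) ->
    exists u1 u2 : E,
      [/\ ea_le u1 v1, ea_le u2 v2 & oplus u1 u2 = Some u].

Definition sub_effect_algebra (B : set E) : Prop :=
  B ea1 /\ forall a b (leba : ea_le b a), B a -> B b -> B (ominus leba).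

Section SubEffectAlgebra.
Variables (B : set E) (subB : sub_effect_algebra B).

Lemma sub_diff a b c : B a -> B b -> oplus b c = Some a -> B c.
Proof.
move=> Ba Bb bc; have le : ea_le b a by exists c.
by rewrite -(ominus_uniq le bc); apply: subB.2.
Qed.

Lemma sub_compl a : B a -> B (compl a).
Proof. by move=> Ba; apply: sub_diff subB.1 Ba (oplus_compl a). Qed.

Lemma sub_ea0 : B ea0.
Proof.
by rewrite -(oplus_ea1 (oplus_comm (oplus_compl ea1))); apply/sub_compl/subB.1.
Qed.

Lemma sub_oplus_closed a b c : B a -> B b -> oplus a b = Some c -> B c.
Proof.
move=> Ba Bb ab.
have [x bx ax] := oplus_assoc ab (oplus_compl c).
have Bx : B x := sub_diff subB.1 Ba ax.
have Bc' : B (compl c) := sub_diff Bx Bb bx.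
by rewrite -(compl_uniq (oplus_comm (oplus_compl c))); apply: sub_compl.
Qed.

Definition sub_oplus (x y : B) : option B := obind insub (oplus (val x) (val y)).

(* [insub] never rejects a sum: [sub_oplus] is defined exactly when [oplus] is *)
Lemma sub_oplusE (x y : B) : omap val (sub_oplus x y) = oplus (val x) (val y).
Proof.
rewrite /sub_oplus; case e: oplus => [c|] //=.
by rewrite insubT ?inE //; apply: sub_oplus_closed e; apply: set_valP.
Qed.

Lemma sub_oplusP (x y z : B) :
  sub_oplus x y = Some z <-> oplus (val x) (val y) = Some (val z).
Proof.
rewrite -sub_oplusE; split=> [-> //|].
by case: sub_oplus => //= t [] /val_inj ->.
Qed.

Lemma sub_oplus_comm (x y z : B) : sub_oplus x y = Some z -> sub_oplus y x = Some z.
Proof. by move=> /sub_oplusP/oplus_comm/sub_oplusP. Qed.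

Lemma sub_oplus_assoc (a b c ab abc : B) :
  sub_oplus a b = Some ab -> sub_oplus ab c = Some abc ->
  exists2 bc, sub_oplus b c = Some bc & sub_oplus a bc = Some abc.
Proof.
move=> /sub_oplusP e1 /sub_oplusP e2.
have [x e3 e4] := oplus_assoc e1 e2.
have Bx : B x by apply: sub_oplus_closed e3; apply: set_valP.
by exists (SigSub (mem_set Bx)); apply/sub_oplusP.
Qed.

Lemma sub_compl_ex (a : B) :
  exists! a' : B, sub_oplus a a' = Some (SigSub (mem_set subB.1)).
Proof.
have Bc := sub_compl (set_valP a).
exists (SigSub (mem_set Bc)); split; first exact/sub_oplusP/oplus_compl.
by move=> x /sub_oplusP/compl_uniq e; apply/val_inj.
Qed.

Lemma sub_oplus_ea1 (a c : B) :
  sub_oplus a (SigSub (mem_set subB.1)) = Some c -> a = SigSub (mem_set sub_ea0).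
Proof. by move=> /sub_oplusP/oplus_ea1 e; apply/val_inj. Qed.

Definition sub_ea : effectAlgebra :=
  EffectAlgebra sub_oplus_comm sub_oplus_assoc sub_compl_ex sub_oplus_ea1.

End SubEffectAlgebra.
End EffectAlgebraOps.

Definition riesz_sub (E : effectAlgebra) (B : set E) : Prop :=
  exists subB : sub_effect_algebra B, riesz_decomposition (sub_ea subB).

Definition block (E : effectAlgebra) (B : set E) : Prop :=
  riesz_sub B /\ forall C : set E, riesz_sub C -> B `<=` C -> C = B.

(* Main.v *)
From HB Require Import structures.
From Stdlib Require Relations_2 Relations_3 Relations_3_facts.
Require Import Defs.
From mathcomp Require Import all_boot.
From mathcomp Require Import ssralg.
From mathcomp Require Import boolp classical_sets.

Set Implicit Arguments.
Unset Strict Implicit.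
Unset Printing Implicit Defensive.

Import GRing.Theory.

Local Open Scope ring_scope.
Local Open Scope classical_set_scope.

(** Call x small relative to y when the sum of x and y is defined.  In a
    homogeneous effect algebra, an element below a sum and small relative to it
    can be distributed over the summands.  This is as much of the Riesz property
    as the hypothesis gives, and the proof consists in never needing more.

    Represent a finite Boolean piece of E by a finite family with sum 1.  Starting
    from the family (a, a'), refine repeatedly: a [step] replaces every member c_i
    by a finite family with sum c_i, all of whose members but at most one (the
    remainder) are small relative to c_i.  Two facts make this work.
    - Steps have the diamond property ([step_diamond]): two decompositions of the
      same c_i, each with only small members and one remainder, have a common
      refinement matrix, since small members can be distributed one after the
      other over the opposite decomposition, and the remainder takes what is left.
      In each row and each column, all entries but at most one are again small
      relative to the sum of that row or column.  Hence any two families reached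
      from (a, a') have a common refinement that is reached from (a, a').
    - An inequality between partial sums of a family becomes an inclusion of index
      sets after one step ([step_absorb]): after cancelling common indices, the
      two sums are disjoint, so that the smaller one is small relative to the
      larger one and distributes over it.

    Let [span a] be the set of all partial sums of families reached from (a, a').
    It contains a.  Given finitely many of its elements, find a family of which
    they are all partial sums; by [step_absorb], the order between them may be
    taken to be inclusion of index sets.  Set differences then give closure under
    differences, and set intersections give the Riesz property.  So [span a] is a
    sub-effect algebra with the Riesz property.

    Such subsets are stable under unions of nonempty chains, because their
    defining conditions involve finitely many elements at a time once the Riesz
    property is reduced to two summands ([riesz_refinementT]).  Zorn's lemma
    extends [span a] to a block. *)

(** * Effect algebras as total commutative monoids *)

(** Adding an absorbing element None for undefined sums makes the operation
    total, so that finite sums are ordinary sums of a commutative monoid and all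
    definedness conditions on them become a single [<> None]. *)
Definition ext (E : effectAlgebra) : Type := option E.

HB.instance Definition _ E := gen_eqMixin (ext E).
HB.instance Definition _ E := gen_choiceMixin (ext E).

Section Ext.
Variable E : effectAlgebra.

Definition ext_add (x y : ext E) : ext E :=
  if x is Some a then (if y is Some b then oplus a b else None) else None.

(** First for a = 1, where 0 is the complement of 1; the general case follows by
    cancelling the complement of a. *)
Lemma oplus0 (a : E) : oplus a ea0 = Some a.
Proof.
have one0 : oplus (ea1 : E) ea0 = Some ea1.
  have h := oplus_compl (ea1 : E).
  by rewrite -(oplus_ea1 (oplus_comm h)).
have [x e1 e2] := oplus_assoc (oplus_comm (oplus_compl a)) one0.
rewrite e1; congr Some; exact: oplus_cancel e2 (oplus_comm (oplus_compl a)).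
Qed.

Lemma ext_addC : commutative ext_add.
Proof.
move=> [a|] [b|] //=; case eab: (oplus a b) => [c|].
  by rewrite (oplus_comm eab).
by case eba: (oplus b a) => [c|] //; rewrite (oplus_comm eba) in eab.
Qed.

(** One implication between the two bracketings suffices: commutativity turns it
    into the other one. *)
Lemma ext_addA : associative ext_add.
Proof.
have addE x y z c : ext_add (ext_add x y) z = Some c ->
    ext_add x (ext_add y z) = Some c.
  case: x y z => [x|] [y|] [z|] //=; last by case: (oplus x y).
  by case exy: (oplus x y) => [xy|] //= /(oplus_assoc exy)[yz -> /=].
move=> x y z; case exyz: (ext_add (ext_add x y) z) => [c|]; first exact: addE.
case exyz': (ext_add x (ext_add y z)) => [c|] //.
by rewrite -exyz ext_addC (ext_addC x) (addE z y x c) // ext_addC (ext_addC z).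
Qed.

Lemma ext_add0 : left_id (Some ea0 : ext E) ext_add.
Proof. by move=> x; rewrite ext_addC; case: x => [x|] //=; apply: oplus0. Qed.

HB.instance Definition _ :=
  GRing.isNmodule.Build (ext E) ext_addA ext_addC ext_add0.

Lemma ext_addE (a b : E) : (Some a : ext E) + Some b = oplus a b.
Proof. by []. Qed.

Definition defined (x : ext E) : Prop := x <> None.

Lemma def_add2l (x y : ext E) : defined (x + y) -> defined x.
Proof. by case: x. Qed.

Lemma def_add2r (x y : ext E) : defined (x + y) -> defined y.
Proof. by rewrite addrC; apply: def_add2l. Qed.

(** Cancellation needs the sum to be defined, because None is absorbing. *)
Lemma ext_addI (x y z : ext E) : defined (x + y) -> x + y = x + z -> y = z.
Proof.
case: x y z => [x|] [y|] [z|] //=; rewrite /defined ?ext_addE //.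
  case xy: (oplus x y) => [s|] // _ /esym xz; congr Some.
  exact: oplus_cancel xy xz.
Qed.

Lemma ext_addr_eq0 (x y : ext E) : x + y = 0 -> x = 0.
Proof.
case: x y => [x|] [y|] // xy.
have [z yz _] := oplus_assoc xy (oplus_comm (oplus0 ea1)).
by move: xy; rewrite (oplus_ea1 yz) ext_addE oplus0.
Qed.

Lemma ext_sum_eq0 (I : finType) (d : I -> ext E) :
  \sum_i d i = 0 -> forall i, d i = 0.
Proof. by move=> + i; rewrite (bigD1 i) //= => /ext_addr_eq0. Qed.

Lemma sum_fst (I J : finType) (F : I * J -> ext E) (i : I) :
  \sum_(p | p.1 == i) F p = \sum_j F (i, j).
Proof.
rewrite (eq_bigl (fun p => (p.1 == i) && true)) => [|p]; last by rewrite andbT.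
rewrite (eq_bigr (fun p => F (p.1, p.2))) => [|[]//].
by rewrite -(pair_big (pred1 i) xpredT (fun i j => F (i, j))) big_pred1_eq.
Qed.

Lemma def_sum (I : finType) (A B : pred I) (d : I -> ext E) :
  subpred A B -> defined (\sum_(i | B i) d i) -> defined (\sum_(i | A i) d i).
Proof.
move=> sAB; rewrite (bigID A) /= => /def_add2l.
congr defined; apply: eq_bigl => i.
by case Ai: (A i); rewrite ?andbF // sAB.
Qed.

(** * Consequences of homogeneity *)

Section Homogeneous.
Hypothesis homE : homogeneous E.

(** Homogeneity without complements: u lies below the complement of s exactly when
    the sum of u and s is defined. *)
Lemma ext_hom (u v1 v2 z : ext E) : u + z = v1 + v2 -> defined (u + (v1 + v2)) ->
  exists u1 r1 u2 r2 : ext E, [/\ u = u1 + u2, u1 + r1 = v1 & u2 + r2 = v2].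
Proof.
case es: (v1 + v2) => [s|] us; last by rewrite addrC.
case: u us => [u|//] us; case: z us => [z|] us; last by rewrite addrC in us.
case: v1 es => [v1|//] es; case: v2 es => [v2|] es; last by rewrite addrC in es.
rewrite ext_addE; case ut: (oplus u s) => [t|] // _.
have [|u1 [u2 [[r1 e1] [r2 e2] e]]] := homE es (ex_intro _ z us).
  have [x ux sx] := oplus_assoc (oplus_comm ut) (oplus_compl t).
  by exists (compl t); rewrite ux (compl_uniq sx).
by exists (Some u1), (Some r1), (Some u2), (Some r2).
Qed.

Lemma hom_sum (T : eqType) (r : seq T) (e : T -> ext E) (u z : ext E) :
    uniq r -> u + z = \sum_(k <- r) e k -> defined (u + \sum_(k <- r) e k) ->
  exists x y : T -> ext E,
    u = \sum_(k <- r) x k /\ {in r, forall k, x k + y k = e k}.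
Proof.
elim: r u z => [|k r IHr] u z /=; rewrite ?big_nil ?big_cons => ur uz du.
  by exists (fun=> 0), (fun=> 0); rewrite big_nil (ext_addr_eq0 uz).
have /andP[kr {}ur] := ur.
have [u1 [r1 [u2 [r2 [eu e1 e2]]]]] := ext_hom uz du.
have [|x [y [eu2 xy]]] := IHr u2 r2 ur e2.
  by move: du; rewrite eu addrACA addrC => /def_add2l.
exists (fun j => if j == k then u1 else x j),
  (fun j => if j == k then r1 else y j).
have nk j : j \in r -> (j == k) = false by apply: contraTF => /eqP->.
rewrite big_cons eqxx eu eu2; split.
  by congr (_ + _); apply: eq_big_seq => j /nk->.
by move=> j; rewrite inE; case: eqVneq => [-> //|_] /= /xy.
Qed.

(** The rows d j are distributed one after the other over what the previous rows
    left of e; smallness persists because the rest of e only decreases. *)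
Lemma small_rows (J K : finType) (r : seq J) (d : J -> ext E) (e : K -> ext E)
    (z : ext E) :
    uniq r -> \sum_(j <- r) d j + z = \sum_k e k -> defined (\sum_k e k) ->
    {in r, forall j, defined (d j + \sum_k e k)} ->
  exists (x : J -> K -> ext E) (y : K -> ext E),
    {in r, forall j, \sum_k x j k = d j} /\
    forall k, \sum_(j <- r) x j k + y k = e k.
Proof.
elim: r e => [|j r IHr] e /=.
  by exists (fun _ _ => 0), e; split => // k; rewrite big_nil add0r.
move=> /andP[jr ur]; rewrite big_cons -addrA => sde de small.
have [|x1 [e' [dj x1e]]] := hom_sum (index_enum_uniq K) sde.
  by apply: small; rewrite mem_head.
have se : \sum_k e k = d j + \sum_k e' k.
  by rewrite dj -big_split; apply: eq_bigr => k _ /=; rewrite x1e ?mem_index_enum.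
have [||i ir|x [y [row col]]] := IHr e' ur.
- by apply: (@ext_addI (d j)); rewrite sde.
- by move: de; rewrite se => /def_add2r.
- have := small i; rewrite inE ir orbT => /(_ isT).
  by rewrite se addrCA => /def_add2r.
have nj i : i \in r -> (i == j) = false by apply: contraTF => /eqP->.
exists (fun i => if i == j then x1 else x i), y; split.
  move=> i; rewrite inE; case: eqVneq => [-> _|_ /= /row //].
  by rewrite dj.
move=> k; rewrite big_cons eqxx -addrA -[RHS]x1e ?mem_index_enum //.
congr (_ + _); rewrite -[RHS]col; congr (_ + _).
by apply: eq_big_seq => i /nj->.
Qed.

(** A common refinement of two decompositions of one element.  Smallness is needed
    on one side only, and there one row w may be exempt: it receives what the other
    rows leave of the columns, and cancellation shows that its sum is right. *)
Lemma sum_matrix (J K : finType) (d : J -> ext E) (e : K -> ext E) (w : J) :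
    \sum_j d j = \sum_k e k -> defined (\sum_k e k) ->
    (forall j, j != w -> defined (d j + \sum_k e k)) ->
  exists x : J -> K -> ext E,
    (forall j, \sum_k x j k = d j) /\ (forall k, \sum_j x j k = e k).
Proof.
move=> sde de small.
pose r := [seq j <- index_enum J | j != w].
have rE (F : J -> ext E) : \sum_j F j = \sum_(j <- r) F j + F w.
  by rewrite (bigD1 w) //= addrC big_filter.
have [|||j|x [y [row col]]] := @small_rows _ _ r d e (d w).
- by rewrite filter_uniq ?index_enum_uniq.
- by rewrite -rE.
- exact: de.
- by rewrite mem_filter => /andP[/small].
exists (fun j k => if j == w then y k else x j k).
have rowr j : j != w -> \sum_k x j k = d j.
  by move=> jw; apply: row; rewrite mem_filter jw mem_index_enum.
have colw k : \sum_(j <- r) (if j == w then y k else x j k) + y k = e k.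
  rewrite -[RHS]col; congr (_ + _); apply: eq_big_seq => j.
  by rewrite mem_filter => /andP[/negbTE->].
split=> [j|k]; last by rewrite rE eqxx colw.
have [->{j}|/rowr//] := eqVneq j w.
have sum_rows : \sum_(j <- r) d j = \sum_(j <- r) \sum_k x j k.
  by apply: eq_big_seq => j; rewrite mem_filter => /andP[/rowr->].
apply: (@ext_addI (\sum_(j <- r) d j)).
  rewrite sum_rows exchange_big -big_split /=.
  by rewrite (eq_bigr e) // => k _; rewrite -[RHS]col.
rewrite -rE sde sum_rows exchange_big -big_split /=.
by apply: eq_bigr => k _; rewrite col.
Qed.

End Homogeneous.

Lemma def_le (x1 x2 z y1 y2 t : ext E) :
  x1 + z = x2 -> y1 + t = y2 -> defined (x2 + y2) -> defined (x1 + y1).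
Proof. by move=> <- <-; rewrite addrACA => /def_add2l. Qed.

(** * Families with sum one and their refinement *)

Record family := Family {
  idx : finType;
  part :> idx -> ext E;
  part_sum : \sum_i part i = Some ea1
}.

Lemma def_part_sum (c : family) (A : pred (idx c)) : defined (\sum_(i | A i) c i).
Proof. by apply: (@def_sum _ _ predT) => //; rewrite part_sum. Qed.

Lemma def_part (c : family) (i : idx c) : defined (c i).
Proof. by have := @def_part_sum c (pred1 i); rewrite big_pred1_eq. Qed.

Lemma def_part_sum2 (c : family) (A B : pred (idx c)) :
  (forall i, A i -> ~~ B i) -> defined (\sum_(i | A i) c i + \sum_(i | B i) c i).
Proof.
move=> AB; have := @def_part_sum c (fun i => A i || B i); rewrite (bigID A) /=.
congr (defined (_ + _)); apply: eq_bigl => i.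
  by case: (A i) => /=; rewrite ?andbF ?andbT.
by have := AB i; case: (A i); case: (B i) => // /(_ isT).
Qed.

Lemma part_sumI (c : family) (A B : pred (idx c)) (z : ext E) :
  subpred A B -> \sum_(i | A i) c i + z = \sum_(i | B i) c i ->
  z = \sum_(i | B i && ~~ A i) c i.
Proof.
move=> sAB Az; apply: (@ext_addI (\sum_(i | A i) c i)).
  by rewrite Az; apply: def_part_sum.
rewrite Az (bigID A) /=; congr (_ + _); apply: eq_bigl => i.
by case Ai: (A i); rewrite ?andbF // sAB.
Qed.

Definition refines (c d : family) (f : idx d -> idx c) : Prop :=
  forall i, \sum_(j | f j == i) d j = c i.

Lemma refines_sum (c d : family) (f : idx d -> idx c) (A : pred (idx c)) :
  refines f -> \sum_(i | A i) c i = \sum_(j | A (f j)) d j.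
Proof.
move=> fP; rewrite [RHS](partition_big f A) //=; apply: eq_bigr => i Ai.
by rewrite -fP; apply: eq_bigl => j; case: eqP => [->|]; rewrite ?Ai ?andbF.
Qed.

(** The section w of f picks a remainder w i in each fibre; it also forces every
    fibre to be nonempty. *)
Definition step (c d : family) : Prop :=
  exists (f : idx d -> idx c) (w : idx c -> idx d),
    [/\ refines f, cancel w f &
        forall j, j != w (f j) -> defined (d j + c (f j))].

(** Both steps decompose each c i; their refinement matrices for the various i are
    put together in one family indexed by all pairs.  An entry in row j and column
    k is small relative to d j as soon as e k is small relative to c i, so the
    remainder of e in the fibre yields the only possible remainder in row j. *)
Lemma step_diamond (homE : homogeneous E) (c d e : family) :
  step c d -> step c e -> exists2 x, step d x & step e x.
Proof.
move=> [f [v [fP vK fsm]]] [g [w [gP wK gsm]]].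
(* Padding with zeros outside the fibre of i makes all matrices the same shape. *)
pose d' i j := if f j == i then d j else 0.
pose e' i k := if g k == i then e k else 0.
have sd i : \sum_j d' i j = c i by rewrite -big_mkcond fP.
have se i : \sum_k e' i k = c i by rewrite -big_mkcond gP.
have /choice[x xP] i : exists x : idx d -> idx e -> ext E,
    (forall j, \sum_k x j k = d' i j) /\ (forall k, \sum_j x j k = e' i k).
  apply: (sum_matrix homE (w := v i)); rewrite se ?sd //; first exact: def_part.
  move=> j jv; rewrite /d'; case: eqP => [fj|_]; last first.
    by rewrite add0r; apply: def_part.
  by rewrite -fj; apply: fsm; rewrite fj.
pose X (p : idx d * idx e) := x (f p.1) p.1 p.2.
have row j : \sum_k X (j, k) = d j by rewrite (xP (f j)).1 /d' eqxx.
(* Off the fibre product, a column of zeros forces the entry to be 0. *)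
have X0 j k : f j != g k -> X (j, k) = 0.
  move=> fg; apply: (ext_sum_eq0 (d := x (f j) ^~ k)).
  by rewrite (xP (f j)).2 /e' eq_sym (negbTE fg).
have col k : \sum_j X (j, k) = e k.
  transitivity (e' (g k) k); last by rewrite /e' eqxx.
  rewrite -(xP (g k)).2; apply: eq_bigr => j _.
  have [fg|fg] := eqVneq (f j) (g k); first by rewrite /X /= fg.
  rewrite X0 //; apply/esym/(ext_sum_eq0 (d := x (g k) j)).
  by rewrite (xP (g k)).1 /d' (negbTE fg).
have sX : \sum_p X p = Some ea1.
  rewrite -(part_sum d) -(eq_bigr _ (fun j _ => row j)) pair_bigA.
  by apply: eq_bigr => -[].
have X_le_d j k : exists z, X (j, k) + z = d j.
  by exists (\sum_(l | l != k) X (j, l)); rewrite -row [RHS](bigD1 k).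
have X_le_e j k : exists z, X (j, k) + z = e k.
  by exists (\sum_(l | l != j) X (l, k)); rewrite -col [RHS](bigD1 j).
have d_le_c j : exists z, d j + z = c (f j).
  by exists (\sum_(l | (f l == f j) && (l != j)) d l); rewrite -fP [RHS](bigD1 j).
have e_le_c k : exists z, e k + z = c (g k).
  by exists (\sum_(l | (g l == g k) && (l != k)) e l); rewrite -gP [RHS](bigD1 k).
exists (Family sX).
- exists fst, (fun j => (j, w (f j))); split => //=.
  + by move=> j; rewrite sum_fst row.
  + case=> j k /=; have [fg|/X0->] := eqVneq (f j) (g k); last first.
      by rewrite add0r => _; apply: def_part.
    rewrite xpair_eqE eqxx /= fg => /gsm.
    have [z ez] := X_le_e j k; have [t et] := d_le_c j.
    by apply: def_le; rewrite ?fg in et; eassumption.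
- exists snd, (fun k => (v (g k), k)); split => //=.
  + move=> k; rewrite -col.
    rewrite (eq_bigr (fun p => X (p.1, p.2))); last by case.
    rewrite -(pair_big xpredT (pred1 k) (fun i k => X (i, k))) /=.
    by apply: eq_bigr => j _; rewrite big_pred1_eq.
  + case=> j k /=; have [fg|/X0->] := eqVneq (f j) (g k); last first.
      by rewrite add0r => _; apply: def_part.
    rewrite xpair_eqE eqxx andbT -fg => /fsm.
    have [z ez] := X_le_d j k; have [t et] := e_le_c k.
    by apply: def_le; rewrite -?fg in et; eassumption.
Qed.

(** Only the members with index in B but not in A are split: each gives away the
    part x i that it receives from the sum over A minus B.  That part is small
    relative to c i because the two index sets are disjoint.  The new A' consists
    of the parts given away and the indices common to A and B. *)
Lemma step_absorb (homE : homogeneous E) (c : family) (A B : pred (idx c))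
    (z : ext E) :
  \sum_(i | A i) c i + z = \sum_(i | B i) c i ->
  exists (d : family) (f : idx d -> idx c) (A' : pred (idx d)),
    [/\ step c d, refines f, subpred A' (B \o f) &
        \sum_(j | A' j) d j = \sum_(i | A i) c i].
Proof.
move=> AzB.
pose N i := A i && ~~ B i; pose V i := B i && ~~ A i.
pose I i := A i && B i.
have sumA : \sum_(i | A i) c i = \sum_(i | I i) c i + \sum_(i | N i) c i.
  by rewrite (bigID B).
have sumB : \sum_(i | B i) c i = \sum_(i | I i) c i + \sum_(i | V i) c i.
  by rewrite (bigID A) /=; congr (_ + _); apply: eq_bigl => i; rewrite andbC.
have NzV : \sum_(i | N i) c i + z = \sum_(i | V i) c i.
  apply: (@ext_addI (\sum_(i | I i) c i)); last by rewrite addrA -sumA -sumB.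
  by rewrite addrA -sumA AzB; apply: def_part_sum.
have NV (W : pred (idx c)) : subpred W V ->
    defined (\sum_(i | N i) c i + \sum_(i | W i) c i).
  move=> WV; apply: def_part_sum2 => i /andP[_ Bi].
  by apply: contra Bi => /WV/andP[].
pose e i := if V i then c i else 0.
have eE : \sum_i e i = \sum_(i | V i) c i by rewrite -big_mkcond.
have [||x [y [sx xy]]] := hom_sum homE (index_enum_uniq (idx c))
  (u := \sum_(i | N i) c i) (z := z) (e := e).
- by rewrite eE.
- by rewrite eE; apply: NV.
have {}xy i : x i + y i = e i by apply: xy; rewrite mem_index_enum.
have x0 i : ~~ V i -> x i = 0.
  by move=> /negbTE Vi; apply: (@ext_addr_eq0 _ (y i)); rewrite xy /e Vi.
(* The index (i, true) carries the part given away, (i, false) the remainder. *)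
pose d (p : idx c * bool) :=
  if p.2 then x p.1 else if V p.1 then y p.1 else c p.1.
have dE i : \sum_b d (i, b) = c i.
  rewrite big_bool /d /=; case Vi: (V i) => /=; last by rewrite x0 ?Vi ?add0r.
  by rewrite xy /e Vi.
have sd : \sum_p d p = Some ea1.
  rewrite -(part_sum c) -(eq_bigr _ (fun i _ => dE i)) pair_bigA.
  by apply: eq_bigr => -[].
have fP : @refines c (Family sd) fst.
  by move=> i /=; rewrite sum_fst dE.
exists (Family sd), fst, (fun p => I p.1 || V p.1 && p.2); split => //.
- exists fst, (fun i => (i, false)); split => //= -[i b] /=.
  rewrite xpair_eqE eqxx /= /d /=; case: b => //= _.
  have [Vi|Vi] := boolP (V i); last by rewrite x0 // add0r; apply: def_part.
  have := NV (pred1 i); rewrite big_pred1_eq => /(_ _).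
  have le_x : x i + \sum_(j | j != i) x j = \sum_(i | N i) c i.
    by rewrite sx [RHS](bigD1 i).
  have le_c : c i + 0 = c i by rewrite addr0.
  move=> h; apply: def_le le_x le_c _; apply: h => j /eqP->; exact: Vi.
- by move=> [i b] /=; rewrite /I /V; case: (A i); case: (B i).
- rewrite /= big_mkcond /=.
  rewrite (eq_bigr (fun p => if I p.1 || V p.1 && p.2 then d (p.1, p.2) else 0));
    last by case.
  rewrite -(pair_bigA _ (fun i b => if I i || V i && b then d (i, b) else 0)) /=.
  rewrite sumA sx [X in _ = X + _]big_mkcond -big_split /=; apply: eq_bigr => i _.
  rewrite big_bool /d /=; have := x0 i; rewrite /I /V /=.
  by case: (A i); case: (B i) => /= h; rewrite ?add0r ?addr0 1?addrC // h.
Qed.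

(** * The sub-effect algebra spanned by one element *)

Definition reach : family -> family -> Prop := Relations_2.Rstar family step.

Lemma reach_trans c d e : reach c d -> reach d e -> reach c e.
Proof. exact: Relations_2_facts.Rstar_transitive. Qed.

Lemma reach_step c d : step c d -> reach c d.
Proof. exact: Relations_2_facts.Rstar_contains_R. Qed.

Lemma reach_refines c d : reach c d -> exists f, @refines c d f.
Proof.
elim=> [{}c|{}c {}d e [f [w [fP _ _]]] _ [g gP]].
  by exists id => i; rewrite big_pred1_eq.
by exists (f \o g) => i; rewrite -fP (refines_sum _ gP).
Qed.

Definition with_compl (a : E) (b : bool) : ext E :=
  if b then Some a else Some (compl a).

Lemma with_compl_sum (a : E) : \sum_b with_compl a b = Some ea1.
Proof. by rewrite big_bool; apply: oplus_compl. Qed.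

Definition start (a : E) : family := Family (with_compl_sum a).

Definition span (a : E) : set E :=
  [set b | exists c, reach (start a) c /\
     exists A : pred (idx c), \sum_(i | A i) c i = Some b].

Lemma span_base a : span a a.
Proof.
exists (start a); split; first exact: Relations_2.Rstar_0.
by exists (pred1 true); rewrite big_pred1_eq.
Qed.

Section Span.
Variable a : E.
Hypothesis homE : homogeneous E.

Lemma reach_directed c d : reach (start a) c -> reach (start a) d ->
  exists2 e, reach c e & reach d e.
Proof.
move=> ac ad.
have sc : Relations_2.Strongly_confluent family step.
  by move=> x y z xy xz; have [t] := step_diamond homE xy xz; exists t.
have [e []] := Relations_3_facts.Strong_confluence _ _ sc _ _ _ ac ad.
by exists e.
Qed.

(** Any u in the span below a given partial sum b is a sum over a subset of the
    indices of b, in a suitable refinement: pass to a common refinement with a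
    family that has u as a partial sum, then absorb u into b. *)
Lemma reach_below (c : family) (B : pred (idx c)) (b u z : E) :
    reach (start a) c -> \sum_(i | B i) c i = Some b ->
    span a u -> oplus u z = Some b ->
  exists (d : family) (f : idx d -> idx c) (U : pred (idx d)),
    [/\ reach (start a) d, refines f, subpred U (B \o f) &
        \sum_(j | U j) d j = Some u].
Proof.
move=> ac cb [c' [ac' [U' c'u]]] uz.
have [e ce c'e] := reach_directed ac ac'.
have [f fP] := reach_refines ce; have [g gP] := reach_refines c'e.
have [|d [h [U [ed hP sU dU]]]] :=
    @step_absorb homE e (fun k => U' (g k)) (fun k => B (f k)) (Some z).
  by rewrite -(refines_sum _ gP) -(refines_sum _ fP) c'u cb.
exists d, (f \o h), U; split=> //.
- by apply: reach_trans ac (reach_trans ce (reach_step ed)).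
- by move=> i; rewrite -fP (refines_sum _ hP).
- by rewrite dU -(refines_sum _ gP).
Qed.

Lemma span_sub_effect_algebra : sub_effect_algebra (span a).
Proof.
split.
  exists (start a); split; first exact: Relations_2.Rstar_0.
  by exists predT; rewrite part_sum.
move=> x y leyx [c [ac [B cB]]] sy.
have yx := ominusP leyx; move: (ominus leyx) yx => z yx.
have [d [f [U [ad fP sU dU]]]] := reach_below ac cB sy yx.
exists d; split => //; exists (fun j => B (f j) && ~~ U j).
apply/esym/part_sumI => //.
by rewrite dU -(refines_sum _ fP) cB.
Qed.

End Span.

(** The Riesz property for two summands, read inside B: all differences are named
    so that they can be required to lie in B. *)
Definition riesz_refinement (B : set E) : Prop :=
  forall u v1 v2 s z : E, B u -> B v1 -> B v2 ->
    oplus v1 v2 = Some s -> oplus u z = Some s ->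
    exists u1 r1 u2 r2 : E, [/\ B u1, B r1, B u2 & B r2] /\
      [/\ oplus u1 u2 = Some u, oplus u1 r1 = Some v1 & oplus u2 r2 = Some v2].

(** In a fine enough family, v1 and v2 are sums over disjoint index sets that
    together make up those of s, and u is a sum over a subset of the latter;
    intersecting that subset with both parts decomposes u. *)
Lemma span_riesz (homE : homogeneous E) (a : E) : riesz_refinement (span a).
Proof.
move=> u v1 v2 s z au av1 av2 v12 uz.
have subA := span_sub_effect_algebra a homE.
have [c [ac [S cS]]] := sub_oplus_closed subA av1 av2 v12.
have [d [f [V [ad fP sV dV]]]] := reach_below homE ac cS av1 v12.
have dS : \sum_(j | S (f j)) d j = Some s by rewrite -(refines_sum _ fP).
have dW : \sum_(j | S (f j) && ~~ V j) d j = Some v2.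
  by apply/esym/part_sumI => //; rewrite dV dS.
have [e [g [U [ae gP sU eU]]]] := reach_below homE ad dS au uz.
have piece (T : pred (idx d)) v : \sum_(j | T j) d j = Some v ->
  exists u1 r1 : E, [/\ span a u1, span a r1, oplus u1 r1 = Some v &
    \sum_(k | U k && T (g k)) e k = Some u1].
  rewrite (refines_sum _ gP) (bigID U) /= => dT.
  case e1: (\sum_(k | T (g k) && U k) e k) dT => [u1|//].
  case e2: (\sum_(k | T (g k) && ~~ U k) e k) => [r1|]; last by rewrite addrC.
  move=> ur; exists u1, r1; split => //.
  - by exists e; split => //; exists (fun k => T (g k) && U k).
  - by exists e; split => //; exists (fun k => T (g k) && ~~ U k).
  - by rewrite -e1; apply: eq_bigl => k; rewrite andbC.
have [u1 [r1 [au1 ar1 e1 s1]]] := piece V v1 dV.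
have [u2 [r2 [au2 ar2 e2 s2]]] := piece _ v2 dW.
exists u1, r1, u2, r2; do 2!split => //.
rewrite -ext_addE -s1 -s2 -eU [RHS](bigID (V \o g)) /=.
apply: (congr1 (fun t : ext E => _ + t)).
apply: eq_bigl => k; have := sU k; rewrite /=.
by case: (U k) => //= ->.
Qed.

End Ext.

(** * From two summands to Riesz sub-effect algebras and blocks *)

Lemma oplus_seqE (F : effectAlgebra) (s : seq F) :
  oplus_seq s = \sum_(x <- s) (Some x : ext F).
Proof.
have foldlE (o : ext F) r :
    foldl (fun o y => obind (fun z => oplus z y) o) o r =
    o + \sum_(x <- r) (Some x : ext F).
  elim: r o => [|y r IHr] o /=; first by rewrite big_nil addr0.
  by rewrite IHr big_cons addrA; case: o.
by case: s => [|x s]; rewrite ?big_nil // big_cons -foldlE.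
Qed.

Lemma riesz_refinementT (F : effectAlgebra) :
  riesz_refinement [set: F] <-> riesz_decomposition F.
Proof.
split=> [refF n u v s|rieszF u v1 v2 s z _ _ _ v12 uz].
  rewrite oplus_seqE => vs us.
  suff [w [vw wu]] : exists w : n.-tuple F,
      (forall i, ea_le (tnth w i) (tnth v i)) /\
      \sum_(x <- w) (Some x : ext F) = Some u.
    by exists w; rewrite oplus_seqE.
  elim: n v u s vs us => [|n IHn] v u s.
    rewrite tuple0 big_nil => -[<-] [z uz]; exists [tuple]; split; first by case.
    by rewrite big_nil; apply/esym/(@ext_addr_eq0 _ (Some u) (Some z)).
  case/tupleP: v => x v; rewrite big_cons => vs [z uz].
  case vt: (\sum_(y <- v) _) vs => [t|] xt; last by rewrite addrC in xt.
  have [u1 [r1 [u2 [r2 [_ [e e1 e2]]]]]] :=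
    refF u x t s z Logic.I Logic.I Logic.I xt uz.
  have [w [vw wu]] := IHn v u2 t vt (ex_intro _ r2 e2).
  exists [tuple of u1 :: w]; split; last by rewrite big_cons wu.
  move=> i; case: (unliftP ord0 i) => [j|] ->; rewrite ?tnthS ?tnth0 //.
  by exists r1.
have [|w [vw wu]] := rieszF 2 u [tuple v1; v2] s v12; first by exists z.
case/tupleP: w vw wu => w1 w; case/tupleP: w => w2 w; rewrite (tuple0 w) /=.
move=> vw wu; have [r1 e1] := vw ord0; have [r2 e2] := vw (lift ord0 ord0).
by exists w1, r1, w2, r2.
Qed.

Lemma riesz_subP (E : effectAlgebra) (B : set E) :
  riesz_sub B <-> sub_effect_algebra B /\ riesz_refinement B.
Proof.
split=> [[subB /riesz_refinementT refB]|[subB refB]].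
  split=> // u v1 v2 s z Bu Bv1 Bv2 v12 uz.
  have Bs := sub_oplus_closed subB Bv1 Bv2 v12.
  have Bz := sub_diff subB Bs Bu uz.
  pose el x (Bx : B x) : sub_ea subB := SigSub (mem_set Bx).
  have [||u1 [r1 [u2 [r2 [_ [e e1 e2]]]]]] :=
    refB (el u Bu) (el v1 Bv1) (el v2 Bv2) (el s Bs) (el z Bz)
    Logic.I Logic.I Logic.I; try exact/sub_oplusP.
  exists (val u1), (val r1), (val u2), (val r2).
  split; first by split; apply: set_valP.
  by split; [move/sub_oplusP: e | move/sub_oplusP: e1 | move/sub_oplusP: e2]; apply.
exists subB; apply/riesz_refinementT => u v1 v2 s z _ _ _.
move=> /(sub_oplusP subB) v12 /(sub_oplusP subB) uz.
have [u1 [r1 [u2 [r2 [[B1 C1 B2 C2] [e e1 e2]]]]]] :=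
  refB _ _ _ _ _ (set_valP u) (set_valP v1) (set_valP v2) v12 uz.
exists (SigSub (mem_set B1)), (SigSub (mem_set C1)),
  (SigSub (mem_set B2)), (SigSub (mem_set C2)).
by split=> //; split; apply/sub_oplusP.
Qed.

Lemma riesz_sub_bigcup (E : effectAlgebra) (G : set (set E)) :
  G !=set0 -> total_on G subset -> (forall X, G X -> riesz_sub X) ->
  riesz_sub (\bigcup_(X in G) X).
Proof.
move=> [X0 GX0] totG GR.
have GS X (GX : G X) := ((riesz_subP X).1 (GR X GX)).1.
have join X Y : G X -> G Y -> exists Z, [/\ G Z, X `<=` Z & Y `<=` Z].
  by move=> GX GY; have [XY|YX] := totG X Y GX GY; [exists Y | exists X]; split.
apply/riesz_subP; split.
  split=> [|b a leab [X GX Xb] [Y GY Ya]].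
    by exists X0 => //; apply: (GS _ GX0).1.
  have [Z [GZ XZ YZ]] := join X Y GX GY.
  by exists Z => //; apply: (GS _ GZ).2; [apply: XZ | apply: YZ].
move=> u v1 v2 s z [X GX Xu] [Y1 GY1 Y1v] [Y2 GY2 Y2v] v12 uz.
have [Y [GY Y1Y Y2Y]] := join Y1 Y2 GY1 GY2.
have [Z [GZ XZ YZ]] := join X Y GX GY.
have [_ refZ] := (riesz_subP Z).1 (GR Z GZ).
have [u1 [r1 [u2 [r2 [[B1 C1 B2 C2] es]]]]] :=
  refZ u v1 v2 s z (XZ _ Xu) (YZ _ (Y1Y _ Y1v)) (YZ _ (Y2Y _ Y2v)) v12 uz.
by exists u1, r1, u2, r2; split=> //; split; exists Z.
Qed.

(** Zorn's lemma is applied to the sets whose union with B has the Riesz property,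
    because then the empty chain has an upper bound too. *)
Lemma riesz_sub_in_block (E : effectAlgebra) (B : set E) :
  riesz_sub B -> exists2 C : set E, block C & B `<=` C.
Proof.
move=> rB; pose P (X : set E) := riesz_sub (B `|` X).
have [|A [PA maxA]] := @Zorn_bigcup E P.
  move=> G GP totG; have [->|/set0P[X0 GX0]] := eqVneq G set0.
    by rewrite /P bigcup_set0 setU0.
  have -> : P (\bigcup_(X in G) X) = riesz_sub (\bigcup_(X in setU B @` G) X).
    by rewrite bigcup_image bigcupUr //; exists X0.
  apply: riesz_sub_bigcup; first by exists (B `|` X0); exists X0.
    move=> _ _ [X GX <-] [Y GY <-].
    by have [XY|YX] := totG X Y GX GY; [left|right]; apply: setUS.
  by move=> _ [X GX <-]; apply: GP.
exists (B `|` A) => //; split=> // C rC BAC; apply/seteqP; split=> // x Cx.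
apply: contrapT => nx; apply: (maxA C); last first.
  by rewrite /P (setUidr (subset_trans (@subsetUl _ _ _) BAC)).
split; first by apply: subset_trans BAC; apply: subsetUr.
by move=> CA; apply: nx; right; apply: CA.
Qed.

Theorem corollary3p13 (E : effectAlgebra) (homE : homogeneous E) :
  [set: E] = \bigcup_(B in [set B : set E | block B]) B.
Proof.
apply/seteqP; split=> // a _.
have rA : riesz_sub (span a).
  apply/riesz_subP; split; first exact: span_sub_effect_algebra.
  exact: span_riesz.
have [C bC aC] := riesz_sub_in_block rA.
by exists C => //; apply: aC; apply: span_base.
Qed.
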